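(* Let $\mathbf{k}$ be a field and $S=\mathbf{k}[e_1,\dots,e_n]$, with the symmetric group $\mathfrak{S}_n$ acting by permuting the variables. For every proper $\mathfrak{S}_n$-invariant monomial ideal $J\subset S$, the quotient $S/J$ is sequentially Cohen--Macaulay.
   Context: $S/J$ is sequentially Cohen--Macaulay if, letting $p=\dim(S/J)+1$, there is a filtration by homogeneous ideals $J=J_0\subseteq J_1\subseteq\cdots\subseteq J_p=S$ such that for each $i=0,\dots,p-1$ the quotient $J_{i+1}/J_i$ is either zero or a Cohen--Macaulay $S$-module of dimension $i$. *)

(* Defs.v *)
From HB Require Import structures.
From mathcomp Require Import all_boot all_order all_algebra all_fingroup.
From mathcomp Require Import mpoly.

Set Implicit Arguments.
Unset Strict Implicit.
Unset Printing Implicit Defensive.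

Import GRing.Theory.
Local Open Scope ring_scope.

(* Ideals are Prop-valued predicates: Krull dimension and depth quantify over
   all ideals and sequences, with no decidability requirement. *)

Section CommutativeAlgebra.

Variable R : comNzRingType.
Implicit Types I A B G : R -> Prop.

Definition ideal I : Prop :=
  [/\ I 0, (forall a b, I a -> I b -> I (a + b)) & (forall r a, I a -> I (r * a))].

Definition ideal_gen G : R -> Prop := fun f =>
  exists s : seq (R * R),
    (forall c, c \in s -> G c.2) /\ f = \sum_(c <- s) c.1 * c.2.

Definition prime_ideal (P : R -> Prop) : Prop :=
  [/\ ideal P, ~ P 1 & forall a b, P (a * b) -> P a \/ P b].

(* A chain C_0 < ... < C_d of prime ideals containing I. *)
Definition prime_chain I (d : nat) (C : nat -> R -> Prop) : Prop :=
  (forall i, (i <= d)%N -> prime_ideal (C i) /\ (forall a, I a -> C i a)) /\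
  (forall i, (i < d)%N ->
     (forall a, C i a -> C i.+1 a) /\ (exists a, C i.+1 a /\ ~ C i a)).

(* dim (R / I) = d; this fails for every d when I is the whole ring. *)
Definition quotient_dim I (d : nat) : Prop :=
  (exists C, prime_chain I d C) /\
  (forall e C, prime_chain I e C -> (e <= d)%N).

(* A pair of ideals B, A with B contained in A stands for the R-module A / B. *)

Definition module_zero A B : Prop := forall a, A a -> B a.

Definition annihilator A B : R -> Prop := fun r => forall a, A a -> B (r * a).

(* Krull dimension of A / B, i.e. of R / Ann(A / B). *)
Definition module_dim A B (d : nat) : Prop := quotient_dim (annihilator A B) d.

(* B + x A, so that (A / B) / x (A / B) is A / (B + x A). *)
Definition add_mul A B (x : R) : R -> Prop := fun f =>
  exists b a, [/\ B b, A a & f = b + x * a].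

(* Each term of s is a nonzerodivisor on the quotient of M = A / B by the
   previous terms, and M / (s) M is nonzero. *)
Fixpoint regular_sequence A B (s : seq R) : Prop :=
  match s with
  | [::] => ~ module_zero A B
  | x :: s' => (forall a, A a -> B (x * a) -> B a) /\
               regular_sequence A (add_mul A B x) s'
  end.

(* The maximal length of an (A / B)-regular sequence in the ideal I is d. *)
Definition module_depth I A B (d : nat) : Prop :=
  (exists s, [/\ (forall x, x \in s -> I x), regular_sequence A B s
               & size s = d]) /\
  (forall s, (forall x, x \in s -> I x) -> regular_sequence A B s ->
     (size s <= d)%N).

End CommutativeAlgebra.

Section PolynomialRing.

Variables (k : fieldType) (n : nat).
Notation S := {mpoly k[n]}.
Implicit Types J A B : S -> Prop.

Definition homogeneous_ideal J : Prop :=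
  exists G : S -> Prop, (forall g, G g -> exists d, g \is d.-homog) /\
    (forall f, J f <-> ideal_gen G f).

Definition monomial_ideal J : Prop :=
  exists G : 'X_{1..n} -> Prop,
    forall f, J f <-> ideal_gen (fun g : S => exists2 m, G m & g = 'X_[m]) f.

Definition symmetric_invariant J : Prop :=
  forall (s : 'S_n) (f : S), J f -> J (msym s f).

(* The ideal (e_1, ..., e_n): vanishing constant coefficient. *)
Definition irrelevant_ideal : S -> Prop := fun f => f@_0%MM = 0.

(* For finitely generated graded modules: depth with respect to the graded
   maximal ideal equals Krull dimension. *)
Definition cohen_macaulay A B : Prop :=
  exists d, module_dim A B d /\ module_depth irrelevant_ideal A B d.

(* Sequential Cohen-Macaulayness of S / J, with p = d.+1. *)
Definition sequentially_cohen_macaulay J : Prop :=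
  exists d, quotient_dim J d /\
  exists F : nat -> S -> Prop,
    [/\ forall f, F 0%N f <-> J f,
        forall f, F d.+1 f,
        forall i, (i <= d.+1)%N -> homogeneous_ideal (F i),
        forall i, (i < d.+1)%N -> forall f, F i f -> F i.+1 f
      & forall i, (i < d.+1)%N ->
          module_zero (F i.+1) (F i) \/
          (cohen_macaulay (F i.+1) (F i) /\ module_dim (F i.+1) (F i) i)].

End PolynomialRing.

(* Main.v *)
Require Import Defs.
From HB Require Import structures.
From mathcomp Require Import all_boot all_order all_algebra all_fingroup.
From mathcomp Require Import mpoly.
From mathcomp Require Import zify ring.
From mathcomp Require classical_sets boolp.

(** For a monomial ideal J with exponent set U, the dimension filtration is
    F_i = (J : (product of any i variables)^oo), intersected over all choices of
    i variables.  When J is symmetric, membership of an exponent a in F_i depends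
    only on its n - i smallest entries (ties broken by index), so the exponents in
    F_(i+1) but not in F_i split into orthants of dimension i.  Raising one of the
    small entries increases their weighted sum or leads into F_i; adjoining the
    orthants by decreasing weight filters F_(i+1) / F_i into copies of
    S / (x_l : l not in s) with #|s| = i.  The elementary symmetric polynomials
    e_i, ..., e_1 form a regular sequence on each of these, hence on
    F_(i+1) / F_i, and the depth is at least i.  Conversely a regular sequence
    lengthens chains of primes over the annihilator, and such chains have length
    at most i by counting independent polynomials of bounded degree. *)

Set Implicit Arguments.
Unset Strict Implicit.
Unset Printing Implicit Defensive.

Import GRing.Theory.
Local Open Scope ring_scope.

(** * Prime ideals, chains of primes and regular sequences *)

Section Ideals.

Variable R : comNzRingType.
Implicit Types (I A B C P T : R -> Prop) (x : R) (s : seq R).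

Lemma ideal_opp I a : ideal I -> I a -> I (- a).
Proof. by case=> _ _ IM Ia; rewrite -mulN1r; apply: IM. Qed.

Lemma ideal_sub I a b : ideal I -> I a -> I b -> I (a - b).
Proof. by move=> idI Ia Ib; case: (idI) => _ ID _; apply: ID => //; exact: ideal_opp. Qed.

Lemma ideal_sum I (J : Type) (r : seq J) (Q : pred J) (F : J -> R) :
  ideal I -> (forall j, Q j -> I (F j)) -> I (\sum_(j <- r | Q j) F j).
Proof. by case=> I0 ID _ FI; apply: big_ind. Qed.

Lemma ideal_gen_ideal (G : R -> Prop) : ideal (ideal_gen G).
Proof.
split.
- by exists [::]; rewrite big_nil.
- move=> _ _ [q [qG ->]] [q' [qG' ->]]; exists (q ++ q'); rewrite big_cat; split=> // c.
  by rewrite mem_cat => /orP[/qG|/qG'].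
- move=> r _ [q [qG ->]]; exists [seq (r * c.1, c.2) | c <- q]; split.
    by move=> _ /mapP[c /qG Gc ->].
  by rewrite big_map mulr_sumr; apply: eq_bigr => c _; rewrite mulrA.
Qed.

Lemma ideal_add_mul A B x : ideal A -> ideal B -> ideal (add_mul A B x).
Proof.
move=> [A0 AD AM] [B0 BD BM]; split.
- by exists 0, 0; split; rewrite // mulr0 addr0.
- move=> _ _ [b [a [Bb Aa ->]]] [b' [a' [Bb' Aa' ->]]].
  exists (b + b'), (a + a'); split; [exact: BD | exact: AD |].
  by rewrite mulrDr addrACA.
- move=> r _ [b [a [Bb Aa ->]]].
  exists (r * b), (r * a); split; [exact: BM | exact: AM |].
  by rewrite mulrDr mulrCA.
Qed.

Lemma annihilator_ideal A B : ideal B -> ideal (annihilator A B).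
Proof.
case=> B0 BD BM; split.
- by move=> a _; rewrite mul0r.
- by move=> r r' Br Br' a Aa; rewrite mulrDl; apply: BD; [apply: Br | apply: Br'].
- by move=> r r' Br a Aa; rewrite -mulrA; apply/BM/Br.
Qed.

Lemma ideal_bigcup (F : (R -> Prop) -> Prop) :
    (exists A, F A) -> (forall A, F A -> ideal A) ->
    classical_sets.total_on F classical_sets.subset ->
  ideal (classical_sets.bigcup F id).
Proof.
move=> [A0 FA0] idF totF; split.
- by exists A0 => //; case: (idF _ FA0).
- move=> a b [A FA Aa] [B FB Bb].
  have [sAB|sBA] := totF _ _ FA FB; [exists B | exists A] => //.
    by case: (idF _ FB) => _ BD _; apply: BD => //; apply: sAB.
  by case: (idF _ FA) => _ AD _; apply: AD => //; apply: sBA.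
- move=> r a [A FA Aa]; exists A => //.
  by case: (idF _ FA) => _ _; apply.
Qed.

(** Zorn's lemma gives [P] maximal among the ideals containing [I] and disjoint from [T]. If [a] and
    [b] lie outside [P], both [P + (a)] and [P + (b)] meet [T]; the product of two such elements
    lies in [T], and would lie in [P] if [a * b] did. *)
Lemma prime_avoiding I T :
    ideal I -> T 1 -> (forall a b, T a -> T b -> T (a * b)) ->
    (forall a, I a -> ~ T a) ->
  exists P, [/\ prime_ideal P, forall a, I a -> P a & forall a, P a -> ~ T a].
Proof.
move=> idI T1 TM IT.
(* The empty set is admitted so that the union of the empty chain qualifies. *)
pose good P := P = (fun=> False) \/
  [/\ ideal P, forall a, I a -> P a & forall a, P a -> ~ T a].
have [P [gP maxP]] : exists P, good P /\ forall Q, classical_sets.proper P Q -> ~ good Q.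
  apply: classical_sets.Zorn_bigcup => F Fgood totF.
  case: (boolp.pselect (exists2 A, F A & exists a, A a)); last first.
    move=> noA; left; apply: boolp.funext => a; apply: boolp.propext.
    by split=> // -[A FA Aa]; apply: noA; exists A => //; exists a.
  move=> [A FA [a Aa]]; right.
  have nonempty B : F B -> (exists b, B b) ->
      [/\ ideal B, forall a, I a -> B a & forall a, B a -> ~ T a].
    by move=> /Fgood[->[]|].
  pose F' B := F B /\ exists b, B b.
  have -> : classical_sets.bigcup F id = classical_sets.bigcup F' id.
    apply: boolp.funext => b; apply: boolp.propext.
    split=> [[B FB Bb]|[B [FB _] Bb]]; exists B => //.
    by split=> //; exists b.
  split.
  - apply: ideal_bigcup; first by exists A; split=> //; exists a.
      by move=> B [FB Bn]; case: (nonempty B FB Bn).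
    by move=> B B' [FB _] [FB' _]; apply: totF.
  - move=> b Ib; have An : exists a, A a by exists a.
    by have [_ IA _] := nonempty A FA An; exists A; [split|apply: IA].
  - by move=> b [B [FB Bn] Bb]; have [_ _] := nonempty B FB Bn; apply.
case: gP => [P0|[idP IP PT]].
  case: (maxP I); last by right.
  rewrite P0; split=> [a //|/(_ 0)]; apply.
  by case: idI.
exists P; split=> //; split=> //; first by move=> P1; apply: (PT 1).
move=> a b Pab; apply: boolp.contrapT => /boolp.not_orP[nPa nPb].
have meets c : ~ P c -> exists p r, P p /\ T (p + c * r).
  move=> nPc; apply: boolp.contrapT => noT; have [P0 PD PM] := idP.
  apply: (maxP (add_mul (fun=> True) P c)).
    split=> [p Pp|/(_ c) sub]; first by exists p, 0; rewrite mulr0 addr0.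
    by apply/nPc/sub; exists 0, 1; rewrite mulr1 add0r.
  right; split.
  - exact: ideal_add_mul.
  - by move=> p /IP Pp; exists p, 0; rewrite mulr0 addr0.
  - by move=> _ [p [r [Pp _ ->]]] Tpr; apply: noT; exists p, r.
have [p [r [Pp Tpr]]] := meets _ nPa; have [q [t [Pq Tqt]]] := meets _ nPb.
apply: (PT ((p + a * r) * (q + b * t))); last exact: TM.
have [_ PD PM] := idP.
have -> : (p + a * r) * (q + b * t) = (q + b * t) * p + a * r * q + r * t * (a * b).
  by ring.
by apply: (PD); [apply: (PD)|]; apply: (PM).
Qed.

Lemma prime_ideal_expr P a N : prime_ideal P -> P (a ^+ N) -> P a.
Proof.
case=> _ P1 PM; elim: N => [|N IH]; first by rewrite expr0 => /P1.
by rewrite exprS => /PM[|/IH].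
Qed.

(* A prime over the annihilator of M / x M properly contains a prime over the
   annihilator of M, because the products t x^N with t outside it do not
   annihilate M. *)
Lemma regular_sequence_chain A B s :
    ideal A -> ideal B -> regular_sequence A B s ->
  exists C : nat -> R -> Prop, prime_chain (annihilator A B) (size s) C.
Proof.
move=> idA; elim: s B => [|x s IH] B idB /=.
  move=> nzM; have := @prime_avoiding (annihilator A B) (fun r => r = 1).
  case=> //; first exact: annihilator_ideal.
  - by move=> a b -> ->; rewrite mulr1.
  - by move=> a annA a1; apply: nzM => b /annA; rewrite a1 mul1r.
  by move=> P [pP AP _]; exists (fun=> P).
case=> regx /(IH _ (ideal_add_mul x idA idB)) [C [primeC incC]].
have [pC0 annC0] := primeC 0%N isT; have [idC0 C01 _] := pC0.
have [A0 _ AM] := idA; have [B0 _ _] := idB.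
have Cx : C 0%N x by apply: annC0 => a Aa; exists 0, a; rewrite add0r.
pose T r := exists t N, ~ C 0%N t /\ r = t * x ^+ N.
have [||||Q [pQ annQ QT]] := @prime_avoiding (annihilator A B) T.
- exact: annihilator_ideal.
- by exists 1, 0%N; rewrite expr0 mulr1.
- move=> _ _ [t [N [nt ->]]] [t' [N' [nt' ->]]]; exists (t * t'), (N + N')%N.
  split; last by rewrite exprD mulrACA.
  by case: pC0 => _ _ CM /CM[].
- move=> r annr [t [N [nCt def_r]]]; apply/nCt/annC0 => a Aa.
  exists (t * a), 0; split=> //; last by rewrite mulr0 addr0.
  move: (annr a Aa); rewrite {r annr}def_r.
  elim: N => [|N IHN]; first by rewrite expr0 mulr1.
  rewrite exprS [t * _]mulrCA -mulrA => Bxa; apply/IHN/regx => //.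
  exact: AM.
have sQC a : Q a -> C 0%N a.
  move=> Qa; apply: boolp.contrapT => nCa; apply: (QT a Qa).
  by exists a, 0%N; rewrite expr0 mulr1.
exists (fun i => if i is j.+1 then C j else Q); split=> [[|i] lti|[|i] lti].
- by split.
- have [pCi annCi] := primeC i lti; split=> // a annA.
  apply: annCi => b Ab; exists (a * b), 0; split=> //; first exact: annA.
  by rewrite mulr0 addr0.
- split=> //; exists x; split=> // Qx; apply: (QT x Qx).
  by exists 1, 1%N; rewrite expr1 mul1r.
- exact: incC.
Qed.

(** Dropping the condition that the final quotient is nonzero lets regularity pass through
    filtrations whose steps may vanish; for monomial ideals a degree argument restores it at the
    end. *)
Fixpoint weakly_regular A B s : Prop :=
  if s is x :: s' then (forall a, A a -> B (x * a) -> B a) /\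
     weakly_regular A (add_mul A B x) s'
  else True.

(* Multiplication by m induces an isomorphism from A / B to A' / B'. *)
Lemma weakly_regular_iso (m : R) A B A' B' s :
    ideal A' -> ideal B' ->
    (forall a, A a -> A' (m * a)) -> (forall b, B b -> B' (m * b)) ->
    (forall a, A a -> B' (m * a) -> B a) ->
    (forall a', A' a' -> exists a b', [/\ A a, B' b' & a' = m * a + b']) ->
    ideal A -> ideal B -> weakly_regular A B s -> weakly_regular A' B' s.
Proof.
move=> idA'; elim: s B B' => //= x s IH B B' idB' AA' BB' inj surj idA idB.
case=> regx regs; have [_ A'D A'M] := idA'; have [B'0 B'D B'M] := idB'.
have [_ AD AM] := idA; have [_ BD BM] := idB; split.
  move=> _ /surj[a [b' [Aa Bb' ->]]]; rewrite mulrDr => B'x.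
  apply: (B'D) => //; apply: BB'; apply: regx => //; apply: inj; first exact: AM.
  rewrite mulrCA; have -> : x * (m * a) = x * (m * a) + x * b' - x * b' by ring.
  by apply: ideal_sub => //; apply: B'M.
apply: (IH (add_mul A B x)) => //; do ?exact: ideal_add_mul.
- move=> _ [b [a [Bb Aa ->]]]; exists (m * b), (m * a).
  by split; [exact: BB' | exact: AA' | ring].
- move=> a Aa [b' [a' [Bb' /surj[a1 [b1 [Aa1 Bb1 ->]]] E]]].
  exists (a - x * a1), a1; split=> //; last by ring.
  apply: inj; first by apply: ideal_sub => //; apply: AM.
  have -> : m * (a - x * a1) = b' + x * b1 by rewrite mulrBr E; ring.
  by apply: B'D => //; apply: B'M.
- move=> a' /surj[a [b' [Aa Bb' ->]]]; exists a, b'; split=> //.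
  by have := AA' a Aa; exists b', 0; split; rewrite ?mulr0 ?addr0 //; case: idA'.
Qed.

(** This concerns the exact sequence 0 -> B/C -> A/C -> A/B -> 0. Since [x] is regular on [A / B],
    the intersection of [B] with [C + x A] is [C + x B], so the sequence stays exact modulo [x]. *)
Lemma weakly_regular_ext A B C s :
    ideal A -> ideal B -> ideal C ->
    (forall b, B b -> A b) -> (forall c, C c -> B c) ->
    weakly_regular A B s -> weakly_regular B C s -> weakly_regular A C s.
Proof.
move=> idA; elim: s B C => //= x s IH B C idB idC BA CB [regA sA] [regB sB].
have [B0 BD BM] := idB; have [_ AD AM] := idA; have [C0 CD CM] := idC.
split; first by move=> a Aa Cxa; exact: regB (regA _ Aa (CB _ Cxa)) Cxa.
apply: (IH (add_mul A B x)) => //; do ?exact: ideal_add_mul.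
- by move=> _ [b [a [/BA Ab Aa ->]]]; apply: AD => //; apply: AM.
- by move=> _ [c [a [/CB Bc Aa ->]]]; exists c, a.
apply: (@weakly_regular_iso 1 B (add_mul B C x)) => //; do ?exact: ideal_add_mul.
- by move=> b Bb; exists b, 0; split; rewrite ?mul1r ?mulr0 ?addr0 //; case: idA.
- by move=> _ [c [b [Cc /BA Ab ->]]]; exists c, b; rewrite mul1r.
- move=> b Bb [c [a [Cc Aa E]]]; exists c, a; split=> //; last by rewrite -E mul1r.
  apply: regA => //; have -> : x * a = b - c by rewrite -(mul1r b) E addrC addKr.
  by apply: ideal_sub => //; apply: CB.
- move=> _ [b [a [Bb Aa ->]]]; exists b, (x * a).
  by rewrite mul1r; split=> //; exists 0, a; rewrite add0r.
Qed.

Lemma weakly_regular_eq A A' B B' s :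
    (forall a, A a <-> A' a) -> (forall a, B a <-> B' a) ->
  weakly_regular A B s -> weakly_regular A' B' s.
Proof.
move=> eA eB; have -> : A = A' by apply: boolp.funext => a; apply: boolp.propext.
have -> // : B = B' by apply: boolp.funext => a; apply: boolp.propext.
Qed.

Lemma weakly_regular_refl A s : ideal A -> weakly_regular A A s.
Proof.
(* The second ideal grows along the sequence, so the induction needs any [B] containing [A]. *)
suff gen B : ideal A -> (forall a, A a -> B a) -> weakly_regular A B s.
  by move=> idA; apply: gen.
elim: s B => //= x s IH B idA AB; split=> [a /AB //|]; apply: IH => // a /AB Ba.
by exists a, 0; rewrite mulr0 addr0; case: idA.
Qed.

End Ideals.

(** * Bounding chains of primes in a polynomial ring *)

Section KrullDimension.

Variables (k : fieldType) (n : nat).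
Notation S := {mpoly k[n]}.
Implicit Types (I P Q : S -> Prop) (f : S) (m : 'X_{1..n}).

Lemma ideal_scale I c f : ideal I -> I f -> I (c *: f).
Proof. by case=> _ _ IM If; rewrite -mul_mpolyC; apply: IM. Qed.

Lemma prime_mpolyX P m : prime_ideal P -> P 'X_[m] -> exists2 j, (0 < m j)%N & P 'X_j.
Proof.
move=> pP; have [_ P1 PM] := pP; rewrite mpolyXE_id.
suff : forall s : seq 'I_n, P (\prod_(j <- s) 'X_j ^+ m j) ->
  exists2 j, (0 < m j)%N & P 'X_j by apply.
elim=> [|j s IH]; first by rewrite big_nil => /P1.
rewrite big_cons => /PM[|/IH //]; case: (posnP (m j)) => [->|mj]; first by rewrite expr0 => /P1.
by move=> /(prime_ideal_expr pP) Pj; exists j.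
Qed.

Definition independent_mod P (T : finType) (g : T -> S) :=
  forall c : T -> k, P (\sum_t c t *: g t) -> forall t, c t = 0.

(** A relation is read from the lowest power of [f] upwards: once the lower coefficients vanish,
    primality of [P] cancels the leading power of [f], and modulo [Q], which contains [f], only the
    block [h i] remains. *)
Lemma independent_mod_powers P Q f (T : finType) (g : T -> S) (r : nat) :
    prime_ideal P -> ideal Q -> (forall a, P a -> Q a) -> Q f -> ~ P f ->
    independent_mod Q g ->
  independent_mod P (fun p : 'I_r * T => f ^+ p.1 * g p.2).
Proof.
move=> pP idQ PQ Qf nPf indQ c; have [_ QD QM] := idQ; have [idP P1 PM] := pP.
pose h (i : 'I_r) := \sum_x c (i, x) *: g x.
have -> : \sum_p c p *: (f ^+ p.1 * g p.2) = \sum_(i < r) f ^+ i * h i.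
  rewrite (eq_bigr (fun p => c (p.1, p.2) *: (f ^+ p.1 * g p.2))); last by case.
  rewrite -(pair_bigA _ (fun (i : 'I_r) x => c (i, x) *: (f ^+ i * g x))) /=.
  apply: eq_bigr => i _; rewrite mulr_sumr; apply: eq_bigr => x _.
  by rewrite scalerAr.
move=> Psum [i x]; have [j ij] := ubnP i; elim: j => // j IH in i ij x *.
have h0 (i' : 'I_r) : (i' < i)%N -> h i' = 0.
  by move=> lti; apply: big1 => y _; rewrite IH ?scale0r //; apply: leq_trans lti _.
apply: (indQ (fun x => c (i, x))).
have E : \sum_(i' < r) f ^+ i' * h i' =
    f ^+ i * (h i + f * \sum_(i' < r | (i < i')%N) f ^+ (i' - i.+1) * h i').
  rewrite (bigD1 i) //= mulrDr; congr (_ + _).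
  rewrite [LHS](bigID (fun i' : 'I_r => (i < i')%N)) /= [X in _ + X]big1 ?addr0.
    rewrite !mulr_sumr; apply: eq_big => [i'|i' /andP[_ lti]].
      by rewrite andb_idl // => lti; rewrite -val_eqE /= gtn_eqF.
    by rewrite !mulrA -exprSr -exprD subnKC.
  move=> i' /andP[ne]; rewrite -leqNgt leq_eqVlt val_eqE (negPf ne) /= => /h0 ->.
  by rewrite mulr0.
move: Psum; rewrite E => /PM[/(prime_ideal_expr pP) //|/PQ Qh].
rewrite -/(h i); rewrite -[h i](addrK (f * \sum_(i' < r | (i < i')%N) f ^+ (i' - i.+1) * h i')).
by apply: ideal_sub => //; rewrite mulrC; apply: QM.
Qed.

(** A lower bound on the growth of the Hilbert function of [S / C 0]: each step down the chain
    multiplies the family by the first [r] powers of an element of the larger prime outside the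
    smaller one. *)
Lemma prime_chain_independent e (C : nat -> S -> Prop) :
    (forall i, (i <= e)%N -> prime_ideal (C i)) ->
    (forall i, (i < e)%N ->
      (forall a, C i a -> C i.+1 a) /\ (exists a, C i.+1 a /\ ~ C i a)) ->
  exists D, forall r, exists (T : finType) (g : T -> S),
    [/\ #|T| = (r ^ e)%N,
        forall x m, m \in msupp (g x) -> (mdeg m <= D * r)%N
      & independent_mod (C 0%N) g].
Proof.
elim: e C => [|e IH] C primeC incC.
  exists 0%N => r; exists unit, (fun=> 1); split.
  - by rewrite card_unit.
  - by move=> _ m; rewrite msupp1 inE => /eqP->; rewrite mdeg0.
  move=> c; rewrite (big_pred1 tt) => [|[] //] C0c [].
  have [idC C01 _] := primeC 0%N isT; apply/eqP/negP => nz; apply: C01.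
  by have := ideal_scale (c tt)^-1 idC C0c; rewrite scalerK //; exact/negP.
have [f [C1f nC0f]] := (incC 0%N isT).2.
have [||D IHD] := IH (fun i => C i.+1).
- by move=> i lti; apply: primeC.
- by move=> i lti; apply: incC.
exists (msize f + D)%N => r; have [T [g [cardT degg indg]]] := IHD r.
exists ('I_r * T)%type, (fun p : 'I_r * T => f ^+ p.1 * g p.2); split.
- by rewrite card_prod card_ord cardT expnS.
- move=> [i x] m /= /msuppM_le/allpairsP[[m1 m2] /= [m1f /degg m2g ->]].
  have deg1 : forall j m', m' \in msupp (f ^+ j) -> (mdeg m' <= j * msize f)%N.
    elim=> [|j IHj] m'; first by rewrite expr0 msupp1 inE => /eqP->; rewrite mdeg0.
    rewrite exprS => /msuppM_le/allpairsP[[m3 m4] /= [/msize_mdeg_lt m3f /IHj m4f ->]].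
    by rewrite mdegD mulSn leq_add // ltnW.
  rewrite mdegD mulnDl leq_add //; apply: leq_trans (deg1 _ _ m1f) _.
  by rewrite mulnC leq_mul2l ltnW ?orbT.
- apply: (@independent_mod_powers _ (C 1%N)) => //; first exact: primeC.
    by case: (primeC 1%N isT).
  by case: (incC 0%N isT).
Qed.

(** Modulo [P] only monomials in the variables of [s] survive, and those of degree at most [B] have
    exponents in a box of size [B.+1 ^ #|s|]. A left kernel vector of the coefficient matrix on this
    box yields a combination lying in [P], hence vanishes. *)
Lemma independent_mod_card P (s : {set 'I_n}) B (T : finType) (g : T -> S) :
    ideal P -> (forall j, j \notin s -> P 'X_j) ->
    (forall x m, m \in msupp (g x) -> (mdeg m <= B)%N) -> independent_mod P g ->
  (#|T| <= B.+1 ^ #|s|)%N.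
Proof.
move=> idP Ps degg indg; have [_ _ PM] := idP.
pose box := {ffun {j | j \in s} -> 'I_B.+1}.
pose mon (h : box) : 'X_{1..n} := [multinom oapp (fun u => h u : nat) 0%N (insub j) | j < n].
pose M := \matrix_(i < #|T|, j < #|box|) (g (enum_val i))@_(mon (enum_val j)).
suff /eqP <- : row_free M.
  rewrite (leq_trans (rank_leq_col _)) //.
  by rewrite card_ffun card_ord card_sig.
apply: inj_row_free => v vM; apply/rowP => i; rewrite mxE.
pose c t := v 0 (enum_rank t); rewrite -[i]enum_valK -/(c _).
apply: indg; set f := \sum_t _; rewrite [f]mpolyE big_seq.
apply: ideal_sum => // m mf; apply: ideal_scale => //.
have fE m' : f@_m' = \sum_t c t * (g t)@_m'.
  by rewrite raddf_sum /=; apply: eq_bigr => t _; rewrite mcoeffZ.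
have [t mg] : exists t, m \in msupp (g t).
  apply: boolp.contrapT => nom; move: mf; rewrite mcoeff_msupp fE big1 ?eqxx // => t _.
  rewrite [_@__]memN_msupp_eq0 ?mulr0 //; apply/negP => mg; apply: nom; by exists t.
have [ms|] := boolP [forall j, (0 < m j)%N ==> (j \in s)].
  pose h : box := [ffun u => inord (m (val u))].
  have mh : m = mon h.
    apply/mnmP => j; rewrite mnmE; case: insubP => [u _ uj|js] /=.
      rewrite ffunE inordK uj // ltnS (leq_trans _ (degg _ _ mg)) //.
      by rewrite mdegE (bigD1 j) //= leq_addr.
    by apply/eqP; rewrite -leqn0 leqNgt; apply: contra js; apply: implyP; move/forallP: ms.
  move: mf; rewrite mcoeff_msupp => /negP[]; apply/eqP.
  move/rowP/(_ (enum_rank h)): vM; rewrite !mxE => <-.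
  rewrite fE (reindex_onto enum_val enum_rank) /=.
    apply: eq_big => [u|u _]; first by rewrite enum_valK eqxx.
    by rewrite /c !mxE enum_rankK mh enum_valK.
  by move=> u _; rewrite enum_rankK.
rewrite negb_forall => /existsP[j]; rewrite negb_imply => /andP[mj js].
have -> : m = (m - U_(j) + U_(j))%MM.
  by apply/mnmP => l; rewrite mnmDE mnmBE mnm1E; case: eqP => [<-|_]; lia.
by rewrite mpolyXD; apply/PM/Ps.
Qed.

Lemma prime_chain_length I i e (C : nat -> S -> Prop) :
    prime_chain I e C ->
    (forall s : {set 'I_n}, #|s| = i.+1 ->
       exists2 m : 'X_{1..n}, (forall j, j \notin s -> m j = 0%N) & I 'X_[m]) ->
  (e <= i)%N.
Proof.
move=> [primeC incC] Imon; rewrite leqNgt; apply/negP => lt_ie.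
have [pC0 IC0] := primeC 0%N isT.
(* These variables survive modulo the smallest prime. Any [i + 1] of them would carry a monomial of
   [I], forcing one of them into [C 0]. *)
pose s := [set j | ~~ boolp.asbool (C 0%N ('X_j : S))].
have les : (#|s| <= i)%N.
  rewrite leqNgt; apply/negP => lts.
  have : [exists t : {set 'I_n}, (t \subset s) && (#|t| == i.+1)].
    have : (0 < 'C(#|s|, i.+1))%N by rewrite bin_gt0.
    rewrite -cards_draws card_gt0 => /set0Pn[t]; rewrite inE => tP.
    by apply/existsP; exists t.
  case/existsP=> t /andP[/subsetP ts /eqP cardt].
  have [m m0 /IC0/(prime_mpolyX pC0)[j mj Cj]] := Imon t cardt.
  have /ts : j \in t by apply: contraLR mj => /m0 ->.
  by rewrite inE => /boolp.asboolP.
have [||D HD] := @prime_chain_independent e C; [by move=> j /primeC[] | by [] |].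
(* Independence gives [r ^ e <= (D * r + 1) ^ #|s|] with [#|s| < e], which fails once
   [r > (D + 1) ^ (e - 1)]. *)
have [T [g [cardT degg indg]]] := HD (D.+1 ^ e.-1).+1.
have [idC0 _ _] := pC0.
have Cs j : j \notin s -> C 0%N 'X_j by rewrite inE negbK => /boolp.asboolP.
have := independent_mod_card idC0 Cs degg indg; rewrite {}cardT.
case: e lt_ie {primeC incC HD indg} degg => // e lt_ie _ /=; set r := (_ ^ e)%N.
apply/negP; rewrite -ltnNge.
have bound : ((D * r.+1).+1 <= D.+1 * r.+1)%N by rewrite mulSn addSn ltnS leq_addl.
have exps : (#|s| <= e)%N by apply: leq_trans les _.
apply: (@leq_ltn_trans ((D.+1 * r.+1) ^ e)%N).
  apply: leq_trans (_ : (D.+1 * r.+1) ^ #|s| <= _)%N; last by rewrite leq_pexp2l.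
  by case: #|s| => // l; rewrite leq_exp2r.
by rewrite expnMn expnS ltn_pmul2r ?expn_gt0.
Qed.

End KrullDimension.

(** * Monomial ideals as sets of exponents, and their orthants *)

Section MonomialIdeals.

Variables (k : fieldType) (n : nat).
Notation S := {mpoly k[n]}.
Implicit Types (U V W : 'X_{1..n} -> Prop) (f : S) (m a c : 'X_{1..n}).
Implicit Types (s t : {set 'I_n}).

Definition up_closed U := forall m c, U m -> U (m + c)%MM.

Definition monomial_span U : S -> Prop := fun f => forall m, m \in msupp f -> U m.

Lemma monomial_span_ideal U : up_closed U -> ideal (monomial_span U).
Proof.
move=> upU; split.
- by move=> m; rewrite msupp0.
- by move=> f g Uf Ug m /msuppD_le; rewrite mem_cat => /orP[/Uf|/Ug].
- move=> r f Uf m /msuppM_le/allpairsP[[m1 m2] /= [_ /Uf Um2 ->]].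
  by rewrite addmC; apply: upU.
Qed.

Lemma monomial_spanX U m : monomial_span U 'X_[m] <-> U m.
Proof.
split=> [|Um m']; last by rewrite msuppX inE => /eqP->.
by apply; rewrite msuppX mem_head.
Qed.

Lemma monomial_span_mulX U m f :
  monomial_span U ('X_[m] * f) <-> monomial_span (fun c => U (m + c)%MM) f.
Proof.
split=> Uf c; rewrite ?[_ * f]mulrC.
  move=> cf; apply: Uf; rewrite mulrC (perm_mem (msuppMX _ _)).
  exact: map_f.
by rewrite (perm_mem (msuppMX _ _)) => /mapP[c' /Uf Uc' ->].
Qed.

Lemma monomial_span_addP U V f :
    monomial_span (fun m => U m \/ V m) f ->
  exists f1 f2, [/\ monomial_span U f1, monomial_span V f2 & f = f1 + f2].
Proof.
move=> UVf; pose F (b : bool) := \sum_(m <- msupp f | boolp.asbool (U m) == b) f@_m *: 'X_[m].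
have FE b m : m \in msupp (F b) -> m \in msupp f /\ boolp.asbool (U m) = b.
  case: (boolP ((m \in msupp f) && (boolp.asbool (U m) == b))).
    by case/andP=> ? /eqP.
  move=> nom; rewrite mcoeff_msupp /F raddf_sum big_seq_cond big1 ?eqxx // => m' m'P.
  rewrite /= mcoeffZ mcoeffX; case: eqP => [E|]; last by rewrite mulr0.
  by rewrite -E m'P in nom.
exists (F true), (F false); split.
- by move=> m /FE[_ /boolp.asboolP].
- by move=> m /FE[mf /negbT/boolp.asboolP nUm]; case: (UVf m mf).
- rewrite {1}[f]mpolyE (bigID (fun m => boolp.asbool (U m) == true)) /=; congr (_ + _).
  by apply: eq_bigl => m; case: boolp.asbool.
Qed.

Lemma monomial_span_multiples m f :
  monomial_span (fun a => exists c, a = (m + c)%MM) f -> exists g, f = 'X_[m] * g.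
Proof.
move=> mf; exists (\sum_(a <- msupp f) f@_a *: 'X_[a - m]).
rewrite mulr_sumr {1}[f]mpolyE !big_seq; apply: eq_bigr => a /mf[c ->].
by rewrite -scalerAr -mpolyXD [(m + c)%MM in RHS]addmC addmK addmC.
Qed.

Lemma monomial_span_homogeneous U : up_closed U -> homogeneous_ideal (monomial_span U).
Proof.
move=> upU; exists (fun g => exists2 m, U m & g = 'X_[m]); split.
  by move=> _ [m _ ->]; exists (mdeg m); rewrite dhomogX.
move=> f; split=> [Uf|[r [Ur ->]]].
  exists [seq ((f@_m)%:MP, 'X_[m]) | m <- msupp f]; split.
    by move=> _ /mapP[m /Uf Um ->]; exists m.
  by rewrite big_map {1}[f]mpolyE; apply: eq_bigr => m _; rewrite /= mul_mpolyC.
have idU := monomial_span_ideal upU; rewrite big_seq; apply: ideal_sum => // x /Ur[m Um ->].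
by case: idU => _ _ UM; apply/UM/monomial_spanX.
Qed.

(** These are the exponents of the prime ideal generated by the variables outside [s]. *)
Definition off s m := exists2 l, l \notin s & (0 < m l)%N.

Definition supported_in s m := forall l, l \notin s -> m l = 0%N.

Lemma off_up_closed s : up_closed (off s).
Proof. by move=> m c [l ls ml]; exists l => //; rewrite mnmDE addn_gt0 ml. Qed.

Lemma supported_inN s m : ~ off s m <-> supported_in s m.
Proof.
split=> [noff l ls|supp [l /supp ->] //].
by apply/eqP; rewrite -leqn0 leqNgt; apply/negP => ml; apply: noff; exists l.
Qed.

(** Multiplication by ['X_[m]] identifies [S / (x_l : l not in s)] with the quotient of the ideal of
    [W] by that of [U]; the condition on [U (m + c)] computes the kernel. *)
Lemma weakly_regular_orthant U W m s (q : seq S) :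
    up_closed U -> up_closed W ->
    (forall a, W a <-> U a \/ exists c, a = (m + c)%MM) ->
    (forall c, U (m + c)%MM <-> off s c) ->
    weakly_regular (fun=> True) (monomial_span (off s)) q ->
  weakly_regular (monomial_span W) (monomial_span U) q.
Proof.
move=> upU upW WE UE.
have idW := monomial_span_ideal upW; have idU := monomial_span_ideal upU.
apply: (@weakly_regular_iso _ 'X_[m]) => //.
- by move=> f _; apply/monomial_span_mulX => c _; apply/WE; right; exists c.
- by move=> f offf; apply/monomial_span_mulX => c /offf/UE.
- by move=> f _ /monomial_span_mulX Uf c /Uf/UE.
- move=> f Wf.
  have [|f1 [f2 [Uf1 Vf2 ->]]] :=
      @monomial_span_addP U (fun a => exists c, a = (m + c)%MM) f.
    by move=> a /Wf/WE.
  by have [g ->] := monomial_span_multiples Vf2; exists g, f1; rewrite addrC.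
- exact/monomial_span_ideal/off_up_closed.
Qed.

(** The order is descending because, modulo the variables outside a set of size [i], the polynomial
    [e_i] is a single monomial and can be treated first. *)
Fixpoint elementary i : seq S := if i is j.+1 then mesym n k i :: elementary j else [::].

Lemma size_elementary i : size (elementary i) = i.
Proof. by elim: i => //= i ->. Qed.

Lemma elementary_irrelevant i x : x \in elementary i -> irrelevant_ideal x.
Proof.
elim: i => //= i IH; rewrite inE => /orP[/eqP->|/IH //].
rewrite /irrelevant_ideal mesymE raddf_sum big1 // => h /eqP cardh.
rewrite /= mcoeffX; case: eqP => // /(congr1 mdeg).
by rewrite mdeg_mesym1 cardh mdeg0.
Qed.

Lemma mesym1_off s c : off s (mesym1 s + c)%MM -> off s c.
Proof.
by case=> l ls; rewrite mnmDE mnmE (negPf ls) => cl; exists l.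
Qed.

(** Every subset of size [#|s|] other than [s] contains an index outside [s]. *)
Lemma mesym_mod_off s :
  monomial_span (off s) (mesym n k #|s| - 'X_[mesym1 s]).
Proof.
have idP := monomial_span_ideal (@off_up_closed s).
rewrite mesymE (bigD1 s) //= addrAC subrr add0r.
apply: ideal_sum => // h /andP[/eqP cardh hs]; apply/monomial_spanX.
have : ~~ (h \subset s).
  by apply: contra hs => sub; rewrite eqEcard sub cardh leqnn.
by case/subsetPn => l lh ls; exists l => //; rewrite mnmE lh.
Qed.

(* On k[x_l : l in s] the top elementary symmetric polynomial is the product of
   the variables; the ideals generated by its initial subproducts filter the
   quotient into copies of polynomial rings in one variable fewer. *)
Lemma elementary_weakly_regular i s : #|s| = i ->
  weakly_regular (fun=> True) (monomial_span (off s)) (elementary i).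
Proof.
elim: i s => //= i IH s cards.
have idP := monomial_span_ideal (@off_up_closed s); have [_ _ PM] := idP.
have modP := @mesym_mod_off s; rewrite cards in modP; set e := mesym n k i.+1 in modP *.
split.
  move=> f _ Pef; have : monomial_span (off s) ('X_[mesym1 s] * f).
    have -> : 'X_[mesym1 s] * f = e * f - f * (e - 'X_[mesym1 s]) by ring.
    exact: ideal_sub idP Pef (PM _ _ modP).
  by move/monomial_span_mulX => Pf m /Pf; apply: mesym1_off.
(* The exponents of the ideal generated by the variables outside [s] and the product of those in
   [t]: the unit ideal for empty [t], and for [t = s] the ideal obtained by adjoining [e]. *)
pose U t m := off s m \/ exists c, m = (mesym1 t + c)%MM.
have upU t : up_closed (U t).
  move=> m c [/off_up_closed offm|[c' ->]]; first by left.
  by right; exists (c' + c)%MM; rewrite addmA.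
have idT : ideal (fun _ : S => True) by [].
apply: (@weakly_regular_eq _ (fun=> True) _ (monomial_span (U s))) => //.
  move=> f; split=> [/monomial_span_addP[f1 [f2 [Pf1 Vf2 ->]]]|].
    have [g ->] := monomial_span_multiples Vf2.
    exists (f1 - g * (e - 'X_[mesym1 s])), g; split=> //; last by ring.
    exact: ideal_sub idP Pf1 (PM _ _ modP).
  move=> [b [g [Pb _ ->]]].
  have -> : b + e * g = (b + g * (e - 'X_[mesym1 s])) + 'X_[mesym1 s] * g by ring.
  have [_ UD UM] := monomial_span_ideal (upU s); have [_ PD _] := idP.
  apply: UD; first by move=> m /(PD _ _ Pb (PM _ _ modP)) offm; left.
  by apply/monomial_span_mulX => c _; right; exists c.
suff gen t : t \subset s -> weakly_regular (fun=> True) (monomial_span (U t)) (elementary i).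
  exact: gen.
have [d] := ubnP #|t|; elim: d t => // d IHd t; rewrite ltnS => td ts.
have [->|[l lt]] := set_0Vmem t.
  apply: weakly_regular_eq (weakly_regular_refl (elementary i) idT) => // f.
  by split=> // _ m _; right; exists m; rewrite mesym1_set0 add0m.
have ls : l \in s by apply: (subsetP ts).
have idU t' := monomial_span_ideal (upU t').
(* Removing [l] from [t] enlarges the ideal, and the quotient of the larger by the smaller is a copy
   of [S] modulo the variables outside [s :\ l], covered by the outer induction. *)
apply: (@weakly_regular_ext _ _ (monomial_span (U (t :\ l)))) => //.
- move=> f Uf m /Uf[offm|[c ->]]; [by left | right].
  exists (U_(l) + c)%MM; rewrite addmA; congr (_ + _)%MM.
  apply/mnmP => j; rewrite mnmDE !mnmE !inE [l == j]eq_sym.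
  by case: eqP => [->|_]; rewrite ?lt ?addn0.
- apply: IHd; last by apply: subset_trans (subD1set _ _) ts.
  by apply: leq_trans td; rewrite [X in (_ < X)%N](cardsD1 l) lt.
apply: (@weakly_regular_orthant _ _ (mesym1 (t :\ l)) (s :\ l)) => //.
- move=> a; split=> [[offa|[c ->]]|[[offa|[c ->]]|[c ->]]].
  + by left; left.
  + by right; exists c.
  + by left.
  + right; exists (U_(l) + c)%MM; rewrite addmA; congr (_ + _)%MM.
    apply/mnmP => j; rewrite mnmDE !mnmE !inE [l == j]eq_sym.
    by case: eqP => [->|_]; rewrite ?lt ?addn0.
  + by right; exists c.
- move=> c; split=> [[[j js]|[c' E]]|[j js cj]].
  + rewrite mnmDE mnmE !inE => cj; exists j; first by rewrite !inE (negPf js) andbF.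
    have jt : j \notin t by apply: contra js; apply: (subsetP ts).
    by rewrite (negPf jt) andbF in cj.
  + exists l; first by rewrite !inE eqxx.
    by move/mnmP/(_ l): E; rewrite !mnmDE !mnmE !inE eqxx lt /=; lia.
  + move: js; rewrite !inE negb_and negbK => /orP[/eqP E|js]; last first.
      by left; exists j => //; rewrite mnmDE addn_gt0 cj orbT.
    right; exists (c - U_(l))%MM; apply/mnmP => j'.
    rewrite !mnmDE !mnmE !inE [l == j']eq_sym.
    case: eqP => [->|_] /=; rewrite ?lt; last by rewrite subn0.
    by rewrite subnKC // -E.
- by apply: IH; have := cardsD1 l s; rewrite ls cards => -[].
Qed.

(* V \ U is the disjoint union of the orthants g + N^(sg a); adjoining them to U
   by decreasing rank keeps the union closed upwards. *)
Lemma orthant_filtration U V (g : 'X_{1..n} -> 'X_{1..n})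
    (sg : 'X_{1..n} -> {set 'I_n}) (r : 'X_{1..n} -> nat) N i :
    up_closed U -> up_closed V -> (forall a, U a -> V a) ->
    (forall a, V a -> ~ U a -> [/\ V (g a), #|sg a| = i & (r a < N)%N]) ->
    (forall a, V a -> ~ U a -> exists2 c, a = (g a + c)%MM & supported_in (sg a) c) ->
    (forall a c, V a -> ~ U a -> supported_in (sg a) c ->
       ~ U (g a + c)%MM /\ r (g a + c)%MM = r a) ->
    (forall a l, V a -> ~ U a -> l \notin sg a -> (r a < r (a + U_(l))%MM)%N) ->
    (forall a b, V a -> ~ U a -> V b -> ~ U b -> r a = r b -> g a = g b /\ sg a = sg b) ->
  weakly_regular (monomial_span V) (monomial_span U) (elementary i).
Proof.
move=> upU upV UV gV decomp orth raise inj.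
pose W d a := U a \/ V a /\ (d <= r a)%N.
have unit_up X : (forall a l, X a -> X (a + U_(l))%MM) -> up_closed X.
  move=> upX a c; rewrite [c]multinomUE_id; elim/big_ind: _ a => [a|x y IHx IHy a Xa|l _ a].
  - by rewrite addm0.
  - by rewrite addmA; apply/IHy/IHx.
  - elim: (c l) => [|q IHq]; first by rewrite mulm0n addm0.
    by move=> Xa; rewrite mulmSr addmA; apply/upX/IHq.
have upW d : up_closed (W d).
  apply: unit_up => a l; case: (boolp.pselect (U a)) => [Ua _|nUa]; first by left; apply: upU.
  case=> // -[Va dr]; right; split; first exact: upV.
  (* An entry outside [sg a] raises the rank by hypothesis; an entry inside moves along the orthant,
     where the rank is constant. *)
  case: (boolP (l \in sg a)) => [ls|/(raise _ _ Va nUa)/ltnW]; last exact: leq_trans.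
  have [c ac suppc] := decomp a Va nUa.
  rewrite ac -addmA (orth a (c + U_(l))%MM Va nUa _).2 // => j js.
  by rewrite mnmDE mnm1E suppc //; case: eqP js => // <-; rewrite ls.
have idW d := monomial_span_ideal (upW d); have idV := monomial_span_ideal upV.
(* At most one orthant has rank [d], so each step adjoins one orthant or nothing. *)
have step d : weakly_regular (monomial_span (W d)) (monomial_span (W d.+1)) (elementary i).
  case: (boolp.pselect (exists2 a, V a /\ ~ U a & r a = d)) => [[a0 [Va0 nUa0] ra0]|none].
    have [Vg card0 _] := gV _ Va0 nUa0.
    apply: (@weakly_regular_orthant _ _ (g a0) (sg a0)) (elementary_weakly_regular card0) => //.
    - move=> a; split=> [[Ua|[Va]]|[[Ua|[Va lt]]|[c ->]]]; [by left; left| |by left| | ].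
      + case: (boolp.pselect (U a)) => [Ua _|nUa]; first by left; left.
        rewrite leq_eqVlt => /orP[/eqP E|lt]; last by left; right.
        right; have [<- _] := inj a a0 Va nUa Va0 nUa0 (etrans (esym E) (esym ra0)).
        by have [c ac _] := decomp a Va nUa; exists c.
      + by right; split=> //; apply: ltnW.
      + apply: upW; right; split=> //; have := (orth a0 0%MM Va0 nUa0 _).2.
        by rewrite addm0 ra0 => -> // l _; rewrite mnm0E.
    - move=> c; split=> [Wc|[l ls cl]].
        apply: boolp.contrapT => /supported_inN suppc; have [nU rc] := orth _ c Va0 nUa0 suppc.
        by case: Wc => // -[_]; rewrite rc ra0 ltnn.
      have -> : c = (U_(l) + (c - U_(l)))%MM.
        by apply/mnmP => j; rewrite mnmDE mnmBE mnm1E; case: eqP => [<-|]; lia.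
      rewrite addmA; apply: upW.
      have supp0 : supported_in (sg a0) 0%MM by move=> j _; rewrite mnm0E.
      have [nUg rg] := orth _ _ Va0 nUa0 supp0; rewrite addm0 in nUg rg.
      have [] := inj _ _ Vg nUg Va0 nUa0 rg => _ sg_g.
      by right; split; [apply: upV | rewrite -ra0 -rg; apply: raise; rewrite // sg_g].
  apply: weakly_regular_eq (weakly_regular_refl (elementary i) (idW d)) => // f.
  split=> Wf m /Wf[Um|[Vm lt]]; [by left| |by left|]; last by right; split=> //; apply: ltnW.
  case: (boolp.pselect (U m)) => [|nUm]; [by left | right; split=> //].
  by rewrite ltn_neqAle lt andbT; apply/eqP => E; apply: none; exists m.
have chain d : weakly_regular (monomial_span V) (monomial_span (W d)) (elementary i).
  elim: d => [|d IHd].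
    apply: weakly_regular_eq (weakly_regular_refl (elementary i) idV) => // f.
    by split=> Vf m /Vf; [right | case=> [/UV|[]]].
  apply: weakly_regular_ext IHd (step d) => //.
    by move=> f Wf m /Wf[/UV|[]].
  by move=> f Wf m /Wf[Um|[Vm lt]]; [left | right; split=> //; apply: ltnW].
(* All ranks are below [N], so [W N] is [U]. *)
apply: weakly_regular_eq (chain N) => // f; split=> Uf m /Uf; last by left.
case=> // -[Vm ler]; apply: boolp.contrapT => nUm.
by have [_ _] := gV m Vm nUm; rewrite ltnNge ler.
Qed.

(* Graded Nakayama: a monomial of least degree in V \ U survives modulo any
   sequence in the irrelevant ideal. *)
Lemma monomial_span_regular U V (q : seq S) :
    up_closed U -> (exists2 m, V m & ~ U m) ->
    (forall x, x \in q -> irrelevant_ideal x) ->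
    weakly_regular (monomial_span V) (monomial_span U) q ->
  regular_sequence (monomial_span V) (monomial_span U) q.
Proof.
move=> upU exm.
pose D d := boolp.asbool (exists2 m, V m /\ ~ U m & mdeg m = d).
have exD : exists d, D d by case: exm => m Vm nUm; exists (mdeg m); apply/boolp.asboolP; exists m.
case: (ex_minnP exD) => d /boolp.asboolP[m0 [Vm0 nUm0] deg0] min0.
(* A contribution to [m0] from a nonconstant monomial of [x] would need a monomial of [V] of smaller
   degree, itself outside [U] because [m0] is. *)
have coef0 x f : irrelevant_ideal x -> monomial_span V f -> (x * f)@_m0 = 0.
  move=> x0 Vf; rewrite mcoeffM big1 // => -[m1 m2] /= /eqP E.
  have [->|nz] := eqVneq (m1 : 'X_{1..n}) 0%MM; first by rewrite x0 mul0r.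
  have [/Vf Vm2|/memN_msupp_eq0 ->] := boolP ((m2 : 'X_{1..n}) \in msupp f); last by rewrite mulr0.
  have nUm2 : ~ U m2 by move=> Um2; apply: nUm0; rewrite E addmC; apply: upU.
  have /min0 : D (mdeg m2) by apply/boolp.asboolP; exists (m2 : 'X_{1..n}).
  move: nz (congr1 mdeg E); rewrite -mdeg_eq0 -lt0n mdegD => m1gt0 degE le_d.
  by lia.
have : forall f, monomial_span U f -> f@_m0 = 0.
  by move=> f Uf; apply: memN_msupp_eq0; apply/negP => /Uf.
(* The induction keeps only the vanishing of the coefficient at [m0] on [B], which survives adding
   multiples of [x] and keeps ['X_[m0]] out. *)
move: (monomial_span U) => B B0; elim: q B B0 => [|x q IH] B B0 irr /=.
  move=> _ /(_ 'X_[m0]) BX; have /B0 : B 'X_[m0] by apply/BX/monomial_spanX.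
  by rewrite mcoeffX eqxx => /eqP; rewrite oner_eq0.
case=> regx regq; split=> //; apply: IH => //; last first.
  by move=> y yq; apply: irr; rewrite inE yq orbT.
move=> _ [b [f [/B0 b0 Vf ->]]]; rewrite mcoeffD b0 add0r; apply: coef0 => //.
by apply: irr; rewrite mem_head.
Qed.

End MonomialIdeals.

(** * Truncation of exponents *)

Section Truncation.

(** Each chosen position, beyond the previous one, is where [u] is least on the remaining tail. *)
Lemma nondecreasing_subsequence (u : nat -> nat) :
  exists phi : nat -> nat, {homo phi : i j / (i < j)%N} /\
    forall i j, (i <= j)%N -> (u (phi i) <= u (phi j))%N.
Proof.
have argmin m : exists p, (m <= p)%N /\ forall q, (m <= q)%N -> (u p <= u q)%N.
  pose D d := boolp.asbool (exists2 p, (m <= p)%N & u p = d).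
  have exD : exists d, D d by exists (u m); apply/boolp.asboolP; exists m.
  case: (ex_minnP exD) => d /boolp.asboolP[p mp <-] min; exists p; split=> // q mq.
  by apply: min; apply/boolp.asboolP; exists q.
have [f fP] := boolp.choice argmin.
pose phi i := iter i (fun p => f p.+1) (f 0%N).
have phi_lt : {homo phi : i j / (i < j)%N}.
  by apply: homo_ltn => [|i]; [exact: ltn_trans | case: (fP (phi i).+1)].
have phi_min i q : (phi i <= q)%N -> (u (phi i) <= u q)%N.
  case: i => [|i] le; first by case: (fP 0%N) => _; apply.
  have [le1 min] := fP (phi i).+1; apply: min; exact: leq_trans le1 le.
by exists phi; split=> // i j /(ltnW_homo phi_lt)/phi_min.
Qed.

Lemma nondecreasing_subsequence_mnm n (a : nat -> 'X_{1..n}) :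
  exists phi : nat -> nat, {homo phi : i j / (i < j)%N} /\
    forall i j l, (i <= j)%N -> (a (phi i) l <= a (phi j) l)%N.
Proof.
suff [phi [phi_lt phiP]] : exists phi : nat -> nat, {homo phi : i j / (i < j)%N} /\
    forall l i j, l \in enum 'I_n -> (i <= j)%N -> (a (phi i) l <= a (phi j) l)%N.
  by exists phi; split=> // i j l; apply: phiP; rewrite mem_enum.
elim: (enum 'I_n) => [|l s [phi [phi_lt phiP]]]; first by exists id; split.
have [psi [psi_lt psiP]] := nondecreasing_subsequence (fun i => a (phi i) l).
exists (phi \o psi); split=> [i j /psi_lt/phi_lt //|l' i j].
rewrite inE => /orP[/eqP->|ls] le; first exact: psiP.
exact: phiP ls (ltnW_homo psi_lt le).
Qed.

Variable n : nat.
Implicit Types (U : 'X_{1..n} -> Prop) (m : 'X_{1..n}).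

Definition truncate D m := [multinom minn (m j) D | j < n].

Lemma up_closed_le U m m' :
  up_closed U -> (forall j, (m j <= m' j)%N) -> U m -> U m'.
Proof.
move=> upU le Um; have -> : m' = (m + (m' - m))%MM; last exact: upU.
by apply/mnmP => j; rewrite mnmDE mnmBE subnKC.
Qed.

(* A form of Dickson's lemma. *)
Lemma up_closed_truncate U : up_closed U -> exists D, forall m, U m -> U (truncate D m).
Proof.
move=> upU; apply: boolp.contrapT => /boolp.forallNP noD.
have bad D : exists m, U m /\ ~ U (truncate D m).
  by have /boolp.existsNP[m /boolp.not_implyP ?] := noD D; exists m.
have [a aP] := boolp.choice bad.
have [phi [phi_lt phiP]] := nondecreasing_subsequence_mnm a.
have phi_ge i : (i <= phi i)%N.
  by elim: i => // i IH; apply: leq_ltn_trans IH (phi_lt _ _ _).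
(* [M] bounds every entry of [a (phi 0)], so [a (phi M)] still dominates that exponent after
   truncation at [phi M >= M]. *)
pose M := mdeg (a (phi 0%N)); apply: (aP (phi M)).2.
apply: (up_closed_le upU _ (aP (phi 0%N)).1) => j.
rewrite mnmE leq_min phiP //= (leq_trans _ (phi_ge M)) //.
by rewrite /M mdegE (bigD1 j) //= leq_addr.
Qed.

End Truncation.

(** * Sets of largest entries and the weight of the remaining ones *)

Section Dominance.

Variable n : nat.
Implicit Types (s t : {set 'I_n}) (a b c m : 'X_{1..n}) (i : nat).

(* The entries of a in s exceed those outside s, ties being broken by index. *)
Definition dominant s a :=
  forall j l, j \in s -> l \notin s -> (a l + (j < l) <= a j)%N.

(** The integer [a j * n + j] encodes an entry and its index lexicographically, turning dominance
    into a comparison of keys. *)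
Lemma dominant_key s a j l : dominant s a -> j \in s -> l \notin s ->
  (a l * n + l < a j * n + j)%N.
Proof.
move=> dom js ls; have := dom _ _ js ls; have ln := ltn_ord l.
have : j != l :> nat by apply: contraNneq ls => /val_inj <-.
case: (ltngtP j l) => //= lt _; rewrite ?addn0 ?addn1 => le.
  have : ((a l).+1 * n <= a j * n)%N by rewrite leq_mul2r le orbT.
  by rewrite mulSn; lia.
by rewrite -addnS leq_add // leq_mul2r le orbT.
Qed.

(** Greedy choice: [s] is enlarged by the index of largest key outside it. *)
Lemma dominant_exists i a : (i <= n)%N -> exists s, #|s| = i /\ dominant s a.
Proof.
elim: i => [_|i IH lt_in].
  by exists set0; rewrite cards0; split=> // j l; rewrite inE.
have [s [cards dom]] := IH (ltnW lt_in).
have [p0 ps0] : exists p, p \notin s.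
  have : (0 < #|~: s|)%N by rewrite cardsCs setCK card_ord cards subn_gt0.
  by rewrite card_gt0 => /set0Pn[p]; rewrite inE; exists p.
case: (@arg_maxnP _ p0 [pred p | p \notin s] (fun p : 'I_n => a p * n + p)%N ps0) => p /= ps maxp.
exists (p |: s); split; first by rewrite cardsU1 ps cards.
move=> j l; rewrite !inE negb_or => js /andP[lp ls].
case/orP: js => [/eqP->|js]; last exact: dom.
have le := maxp l ls; have nl : l != p :> nat by rewrite val_eqE.
have := ltn_ord l; have := ltn_ord p => pn ln.
have [lt|ge] := ltnP (a p) (a l).
  have : ((a p).+1 * n <= a l * n)%N by rewrite leq_mul2r lt orbT.
  by rewrite mulSn; lia.
move: ge; rewrite leq_eqVlt => /orP[/eqP E|lt]; last by case: (p < l)%N; lia.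
by move: le; rewrite E; case: ltnP; lia.
Qed.

Lemma dominant_sub s t a : dominant s a -> dominant t a -> (#|s| <= #|t|)%N -> s \subset t.
Proof.
move=> doms domt le; apply/subsetPn => -[j js jt].
have [l lt ls] : exists2 l, l \in t & l \notin s.
  apply/subsetPn; apply: contraL le => /= ts; rewrite -ltnNge proper_card //.
  by apply/properP; split=> //; exists j.
have := dominant_key doms js ls; have := dominant_key domt lt jt.
by lia.
Qed.

Lemma dominant_unique s t a : dominant s a -> dominant t a -> #|s| = #|t| -> s = t.
Proof.
move=> doms domt card; apply/eqP; rewrite eqEsubset.
by rewrite (dominant_sub doms domt) ?card // (dominant_sub domt doms) ?card.
Qed.

Lemma dominant_add s a c : dominant s a -> supported_in s c -> dominant s (a + c)%MM.
Proof.
move=> dom supp j l js ls; rewrite !mnmDE (supp l ls) addn0.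
exact: leq_trans (dom j l js ls) (leq_addr _ _).
Qed.

(* The least element with dominant set s and the entries of a outside s. *)
Definition corner s a :=
  [multinom if j \in s then \max_(l | l \notin s) (a l + (j < l))%N else a j | j < n].

Lemma corner_dominant s a : dominant s (corner s a).
Proof.
move=> j l js ls; rewrite !mnmE js (negPf ls).
exact: (@leq_bigmax_cond _ [pred l | l \notin s] (fun l : 'I_n => a l + (j < l))%N).
Qed.

Lemma corner_off s a l : l \notin s -> corner s a l = a l.
Proof. by move=> ls; rewrite mnmE (negPf ls). Qed.

Lemma corner_le s a j : dominant s a -> (corner s a j <= a j)%N.
Proof.
move=> dom; rewrite mnmE; case: ifP => // js.
by apply/bigmax_leqP => l ls; apply: dom.
Qed.

Lemma eq_corner s a b : (forall l, l \notin s -> a l = b l) -> corner s a = corner s b.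
Proof.
move=> eqab; apply/mnmP => j; rewrite !mnmE; case: ifPn => [_|/eqab //].
by apply: eq_bigr => l /eqab ->.
Qed.

(** The summands are the keys of [dominant_key]; including the index makes the dominant set the
    strict minimiser among sets of its size, even with equal entries. *)
Definition off_weight s a := (\sum_(l | l \notin s) (a l * n + l))%N.

Lemma ltn_sum_separated (T : finType) (X Y : {set T}) (f : T -> nat) :
    #|X| = #|Y| -> X != set0 -> (forall x y, x \in X -> y \in Y -> (f x < f y)%N) ->
  (\sum_(x in X) f x < \sum_(y in Y) f y)%N.
Proof.
move=> card X0 lt; pose M := \max_(x in X) f x.
apply: (@leq_ltn_trans (#|X| * M)).
  by rewrite -sum_nat_const leq_sum // => x; apply: leq_bigmax_cond.
apply: (@leq_trans (#|Y| * M.+1)); first by rewrite card ltn_pmul2l // -card card_gt0.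
rewrite -sum_nat_const leq_sum // => y yY.
rewrite -card_gt0 in X0; have [x xX maxE] := eq_bigmax_cond f X0.
by rewrite /M maxE; apply: lt.
Qed.

(** Terms outside both sets cancel; there remain the keys on [t :\: s] against the larger keys on
    [s :\: t], a set of the same size. *)
Lemma off_weight_min s t a : dominant s a -> #|t| = #|s| -> t != s ->
  (off_weight s a < off_weight t a)%N.
Proof.
move=> dom card nts; rewrite /off_weight.
rewrite (bigID (fun l => l \in t)) [X in (_ < X)%N](bigID (fun l => l \in s)) /=.
rewrite [X in (_ < _ + X)%N](eq_bigl (fun l => (l \notin s) && (l \notin t))); last first.
  by move=> l; rewrite andbC.
rewrite ltn_add2r.
rewrite (eq_bigl (mem (t :\: s))) => [|l]; last by rewrite !inE.
rewrite [X in (_ < X)%N](eq_bigl (mem (s :\: t))) => [|l]; last by rewrite !inE.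
apply: ltn_sum_separated.
- by have := cardsID t s; have := cardsID s t; rewrite setIC; lia.
- by rewrite setD_eq0; apply: contra nts => ts; rewrite eqEcard ts card leqnn.
- by move=> l j; rewrite !inE => /andP[ls _] /andP[_ js]; exact: dominant_key dom js ls.
Qed.

(** If the dominant set is unchanged, the raised entry adds [n]. Otherwise [t] already has larger
    weight at [a], and raising an entry does not decrease it. *)
Lemma off_weight_raise s t a l :
    dominant s a -> dominant t (a + U_(l))%MM -> #|t| = #|s| -> l \notin s ->
  (off_weight s a < off_weight t (a + U_(l))%MM)%N.
Proof.
move=> doms domt card ls.
have le : (off_weight t a <= off_weight t (a + U_(l))%MM)%N.
  by apply: leq_sum => j _; rewrite leq_add2r leq_mul2r mnmDE leq_addr orbT.
have [E|nts] := eqVneq t s; last exact: leq_trans (off_weight_min doms card nts) le.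
rewrite E /off_weight (bigD1 l) //= [X in (_ < X)%N](bigD1 l) //= -addSn leq_add //.
  by rewrite mnmDE mnm1E eqxx addn1 mulSn; have := ltn_ord l; lia.
by apply: leq_sum => j _; rewrite leq_add2r leq_mul2r mnmDE leq_addr orbT.
Qed.

End Dominance.

(** * The dimension filtration of a symmetric monomial ideal *)

Section SymmetricIdeals.

Variables (n : nat) (U : 'X_{1..n} -> Prop) (D : nat).
Hypothesis U_up : up_closed U.
Hypothesis U_sym : forall (p : 'S_n) m, U m -> U [multinom m (p j) | j < n].
Hypothesis U_trunc : forall m, U m -> U (truncate D m).

Implicit Types (s t : {set 'I_n}) (a b c m : 'X_{1..n}) (i : nat).

(* By [U_trunc], adding D to an entry has the effect of making it infinite. *)
Definition lift s a := [multinom (a j + (j \in s) * D)%N | j < n].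

Lemma lift_le s a b : (forall l, l \notin s -> (a l <= b l)%N) -> U (lift s a) -> U (lift s b).
Proof.
move=> le /U_trunc; apply: up_closed_le => // j; rewrite !mnmE.
case: (boolP (j \in s)) => [_|/le]; first by rewrite mul1n; lia.
by rewrite !mul0n; lia.
Qed.

(** Lifting the dominant set leaves the smallest entries, the strongest condition. An exchange moves
    [t] towards [s]: [q] is replaced by [p], and the transposition puts the unlifted [a q] at [p],
    where it is at most [a p]. *)
Lemma lift_dominant s t a : dominant s a -> #|t| = #|s| -> U (lift s a) -> U (lift t a).
Proof.
move=> dom; have [d] := ubnP #|t :\: s|; elim: d t => // d IH t; rewrite ltnS => led card Us.
have [ts|/subsetPn[q qt qs]] := boolP (t \subset s).
  by have /eqP -> : t == s by rewrite eqEcard ts card leqnn.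
have [p ps pt] : exists2 p, p \in s & p \notin t.
  apply/subsetPn; apply: contraNN qs => st.
  by have /eqP -> : s == t by rewrite eqEcard st card leqnn.
have pq : p != q by apply: contraNneq pt => ->.
pose t' := p |: t :\ q.
have cardt' : #|t'| = #|s|.
  by rewrite cardsU1 !inE (negPf pt) andbF -card [in RHS](cardsD1 q) qt.
have /U_trunc/(U_sym (tperm p q)) : U (lift t' a).
  apply: IH => //; apply: leq_trans led; apply: proper_card; apply/properP; split.
    apply/subsetP => j; rewrite !inE => /andP[js /predU1P[jp|/andP[_ ->]]].
      by rewrite jp ps in js.
    by rewrite js.
  by exists q; rewrite !inE ?qs ?qt // eqxx /= orbF [q == p]eq_sym (negPf pq).
apply: up_closed_le => // j; rewrite !mnmE !inE.
case: tpermP => [->|->|/eqP jp /eqP jq].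
- rewrite eq_sym (negPf pq) eqxx (negPf pt) /=.
  by have := dom _ _ ps qs; lia.
- by rewrite eqxx qt; lia.
- by rewrite (negPf jp) jq /=; lia.
Qed.

(** The exponents of [F_i]: raising the entries in [s] by [D] expresses saturation by the product of
    the variables in [s]. *)
Definition colon i a := forall s, #|s| = i -> U (lift s a).

Lemma colon_up i : up_closed (colon i).
Proof.
move=> a c Ua s cards; apply: up_closed_le (Ua s cards) => // j.
by rewrite !mnmE; lia.
Qed.

Lemma colonE i s a : dominant s a -> #|s| = i -> colon i a <-> U (lift s a).
Proof.
move=> dom cards; split=> [|Us t cardt]; first exact.
by apply: lift_dominant dom _ Us; rewrite cards.
Qed.

Lemma colon0 a : colon 0 a <-> U a.
Proof.
have lift0 : lift set0 a = a by apply/mnmP => j; rewrite mnmE inE addn0.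
split=> [/(_ set0 (cards0 _))|Ua s /cards0_eq ->]; by rewrite lift0.
Qed.

Lemma colonS i a : (i < n)%N -> colon i a -> colon i.+1 a.
Proof.
move=> lt Ua t cardt.
have [j jt] : exists j, j \in t by apply/set0Pn; rewrite -card_gt0 cardt.
have := cardsD1 j t; rewrite jt cardt => -[/esym/Ua].
by apply: up_closed_le => // l; rewrite !mnmE !inE; case: (l == j); case: (l \in t); lia.
Qed.

(** A dominant set of size [i + 1] for the corner contains [s], and the corner agrees with [a]
    outside [s]. For [i = n] no set has size [i + 1]. *)
Lemma colon_corner i s a : (i <= n)%N -> dominant s a -> #|s| = i ->
  colon i.+1 a -> colon i.+1 (corner s a).
Proof.
rewrite leq_eqVlt => /orP[/eqP-> _ _ _ t cardt|lt dom cards Va].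
  by have := max_card t; rewrite card_ord cardt ltnn.
have [t [cardt domt]] := dominant_exists (corner s a) lt.
apply/(colonE domt cardt); have st : s \subset t.
  by apply: dominant_sub domt _; [exact: corner_dominant | rewrite cards cardt].
apply: lift_le (Va t cardt) => l lt'; rewrite corner_off //.
by apply: contra lt'; apply/subsetP.
Qed.

(** After truncation an entry of at least [D] counts as infinite, so lifting it along with [s]
    changes nothing and [a] would lie in [colon i]. *)
Lemma colon_bounded i s a l : dominant s a -> #|s| = i ->
  colon i.+1 a -> ~ colon i a -> l \notin s -> (a l < D)%N.
Proof.
move=> dom cards Va nUa ls; rewrite ltnNge; apply/negP => leD.
apply/nUa/(colonE dom cards).
have /Va/U_trunc : #|l |: s| = i.+1 by rewrite cardsU1 ls cards.
apply: up_closed_le => // j; rewrite !mnmE !inE.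
by case: eqP => [->|_]; case: (_ \in s); lia.
Qed.

Lemma colon_weakly_regular (k : fieldType) i : (i <= n)%N ->
  weakly_regular (@monomial_span k n (colon i.+1)) (monomial_span (colon i)) (elementary k n i).
Proof.
move=> le_in.
have [sg sgP] := boolp.choice (fun a => dominant_exists a le_in).
have card_sg a : #|sg a| = i by case: (sgP a).
have dom_sg a : dominant (sg a) a by case: (sgP a).
have sg_eq s a : dominant s a -> #|s| = i -> sg a = s.
  by move=> dom card; apply: dominant_unique (dom_sg a) dom _; rewrite card_sg.
have sub a : colon i a -> colon i.+1 a.
  move: le_in; rewrite leq_eqVlt => /orP[/eqP E _ t cardt|lt]; last exact: colonS.
  by have := max_card t; rewrite card_ord cardt E ltnn.
pose g a := corner (sg a) a; pose wt a := off_weight (sg a) a.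
(* The relevant corners have entries at most [D]: those outside the dominant set are below [D], and
   those inside are maxima of such entries plus 0 or 1. So their codes are bounded by some [K]. *)
pose mon (h : {ffun 'I_n -> 'I_D.+1}) := [multinom nat_of_ord (h j) | j < n].
pose K := (\max_h pickle (mon h)).+1.
have gK a : colon i.+1 a -> ~ colon i a -> (pickle (g a) < K)%N.
  move=> Va nUa; pose h : {ffun 'I_n -> 'I_D.+1} := [ffun j => inord (g a j)].
  have bnd l : l \notin sg a -> (a l < D)%N by exact: colon_bounded (dom_sg a) (card_sg a) Va nUa.
  have -> : g a = mon h.
    apply/mnmP => j; rewrite [RHS]mnmE ffunE inordK // ltnS mnmE.
    case: ifPn => [_|/bnd/ltnW //]; apply/bigmax_leqP => l /bnd.
    by case: (j < l)%N; lia.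
  by rewrite ltnS; exact: leq_bigmax.
(* The weight is the leading digit in base [K], so raising a small entry raises the rank; the code
   of the corner is the last digit and separates corners of equal weight. *)
apply: (@orthant_filtration _ _ _ _ g sg (fun a => wt a * K + pickle (g a))%N
          ((n * (D * n + n)).+1 * K)%N).
- exact: colon_up.
- exact: colon_up.
- exact: sub.
- move=> a Va nUa; split=> //; first exact: colon_corner.
  have wt_le : (wt a <= n * (D * n + n))%N.
    rewrite /wt /off_weight -[X in (_ <= X * _)%N]card_ord -sum_nat_const.
    rewrite [X in (_ <= X)%N](bigID (fun l => l \notin sg a)) /=.
    apply: leq_trans (leq_addr _ _); apply: leq_sum => l ls; apply: leq_add; last exact: ltnW.
    by rewrite leq_mul2r ltnW ?orbT // (colon_bounded (dom_sg a) (card_sg a) Va nUa ls).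
  have := gK a Va nUa; have : (wt a * K <= n * (D * n + n) * K)%N by rewrite leq_mul2r wt_le orbT.
  by rewrite mulSn; lia.
- move=> a Va nUa; exists (a - g a)%MM => [|l ls].
    by apply/mnmP => j; rewrite mnmDE mnmBE subnKC // corner_le.
  by rewrite mnmBE corner_off // subnn.
- move=> a c Va nUa suppc; set b := (g a + c)%MM.
  have domb : dominant (sg a) b by apply: dominant_add => //; apply: corner_dominant.
  have sgb := sg_eq _ _ domb (card_sg a).
  have bE l : l \notin sg a -> b l = a l by move=> ls; rewrite mnmDE suppc // addn0 corner_off.
  split.
    move/(colonE domb (card_sg a)) => Ub; apply/nUa/(colonE (dom_sg a) (card_sg a)).
    by apply: lift_le Ub => l /bE ->.
  rewrite /g /wt sgb (eq_corner bE); congr (_ * _ + _)%N.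
  by apply: eq_bigr => l /bE ->.
- move=> a l Va nUa ls.
  have lt : (wt a < wt (a + U_(l))%MM)%N.
    by apply: off_weight_raise; rewrite ?card_sg.
  have : ((wt a).+1 * K <= wt (a + U_(l))%MM * K)%N by rewrite leq_mul2r lt orbT.
  have := gK a Va nUa.
  by rewrite mulSn; lia.
- move=> a b Va nUa Vb nUb E.
  have : pickle (g a) = pickle (g b).
    by have := congr1 (modn^~ K) E; rewrite !modnMDl !modn_small ?gK.
  move/(pcan_inj pickleK) => gE; split=> //.
  have sgg c : sg (g c) = sg c by apply: sg_eq; [exact: corner_dominant | exact: card_sg].
  by rewrite -sgg gE sgg.
Qed.

End SymmetricIdeals.

(** * Cohen--Macaulay quotients and the final assembly *)

Section SequentiallyCohenMacaulay.

Variables (k : fieldType) (n : nat).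
Notation S := {mpoly k[n]}.

Lemma monomial_ideal_span (J : S -> Prop) : monomial_ideal J ->
  up_closed (fun m => J 'X_[m]) /\ forall f, J f <-> monomial_span (fun m => J 'X_[m]) f.
Proof.
case=> G JG; set gens := fun g : S => exists2 m, G m & g = 'X_[m] in JG.
have idJ : ideal J.
  have [g0 gD gM] := ideal_gen_ideal gens.
  split=> [|a b /JG Ja /JG Jb|r a /JG Ja]; apply/JG; [exact: g0|exact: gD|exact: gM].
have [J0 JD JM] := idJ.
have upJ : up_closed (fun m => J 'X_[m]) by move=> m c Jm; rewrite mpolyXD mulrC; apply: JM.
split=> // f; split=> [/JG[q [qG ->]]|Jf].
  have [_ _ spanM] := monomial_span_ideal k upJ.
  rewrite big_seq; apply: ideal_sum => [|c cq]; first exact: monomial_span_ideal.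
  apply: spanM; have [m Gm ->] := qG c cq; apply/monomial_spanX/JG.
  exists [:: (1, 'X_[m])]; rewrite big_seq1 mul1r; split=> // d.
  by rewrite inE => /eqP->; exists m.
by rewrite [f]mpolyE big_seq; apply: ideal_sum => // m /Jf Jm; apply: ideal_scale.
Qed.

(** Every regular sequence yields a chain of primes of the same length, so the bound on chains
    limits both dimension and depth, and [q] attains both. *)
Lemma cohen_macaulay_of_regular (A B : S -> Prop) i (q : seq S) :
    ideal A -> ideal B -> size q = i ->
    (forall x, x \in q -> irrelevant_ideal x) -> regular_sequence A B q ->
    (forall e C, prime_chain (annihilator A B) e C -> (e <= i)%N) ->
  cohen_macaulay A B /\ module_dim A B i.
Proof.
move=> idA idB sizeq irr regq bound.
have dimAB : module_dim A B i.
  by split=> //; rewrite -sizeq; apply: regular_sequence_chain.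
split=> //; exists i; split=> //; split; first by exists q.
by move=> q' _ /(regular_sequence_chain idA idB)[C /bound].
Qed.

End SequentiallyCohenMacaulay.

Theorem mainTheorem7 (k : fieldType) (n : nat) (J : {mpoly k[n]} -> Prop)
    (J_monomial : monomial_ideal J)
    (J_proper : exists f, ~ J f)
    (J_invariant : symmetric_invariant J) :
  sequentially_cohen_macaulay J.
Proof.
have [upU JE] := monomial_ideal_span J_monomial; set U := fun m => J 'X_[m] in upU JE.
have U_sym (p : 'S_n) m : U m -> U [multinom m (p j) | j < n].
  (* [msym] permutes exponents by the inverse permutation. *)
  by move/(J_invariant p^-1%g); rewrite msymX invgK.
have [D U_trunc] := up_closed_truncate upU.
have upc i := @colon_up n U D upU i.
have idc i := monomial_span_ideal k (upc i).
(* [d] will be the dimension of [S / J]. The least index at which [colon] is everything exists, as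
   no set has [n + 1] variables, and is positive, as [colon 0] describes the proper ideal [J]. *)
have [d [le_dn full proper]] : exists d, [/\ (d <= n)%N, forall a, colon U D d.+1 a
    & exists2 a, True & ~ colon U D d a].
  pose P i := boolp.asbool (forall a, colon U D i a).
  have exP : exists i, P i.
    exists n.+1; apply/boolp.asboolP => a t cardt.
    by have := max_card t; rewrite card_ord cardt ltnn.
  case: (ex_minnP exP) => -[|d] /boolp.asboolP full min.
    case: J_proper => f []; apply/JE => m _; exact/(colon0 U D)/full.
  exists d; split=> //.
    rewrite -ltnS; apply: min; apply/boolp.asboolP => a t cardt.
    by have := max_card t; rewrite card_ord cardt ltnn.
  apply: boolp.contrapT => none; suff /min : P d by rewrite ltnn.
  by apply/boolp.asboolP => a; apply: boolp.contrapT => nUa; apply: none; exists a.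
have mono i : (i <= d)%N -> forall a, colon U D i a -> colon U D i.+1 a.
  rewrite leq_eqVlt => /orP[/eqP-> a _|lt a]; first exact: full.
  by move=> Ua; exact: (colonS upU (leq_trans lt le_dn) Ua).
have J_colon i f : (i <= d.+1)%N -> J f -> monomial_span (colon U D i) f.
  move=> le /JE Jf m /Jf Um t _; apply: up_closed_le Um => // j.
  by rewrite mnmE leq_addr.
have pureq i : (i <= d)%N -> (exists2 a, colon U D i.+1 a & ~ colon U D i a) ->
    regular_sequence (monomial_span (colon U D i.+1)) (monomial_span (colon U D i))
      (elementary k n i).
  move=> le ex; apply: monomial_span_regular => //; first exact: elementary_irrelevant.
  by apply: colon_weakly_regular => //; apply: leq_trans le le_dn.
have reg_d : regular_sequence (monomial_span (colon U D d.+1))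
    (monomial_span (colon U D d)) (elementary k n d).
  by apply: pureq => //; case: proper => a _ nUa; exists a.
exists d; split.
  split.
    (* [J] annihilates [F_(d+1) / F_d], so a chain over that annihilator is a chain over [J]. *)
    have [C [primeC incC]] := regular_sequence_chain (idc _) (idc _) reg_d.
    rewrite size_elementary in primeC incC; exists C; split=> // i /primeC[pC annC].
    split=> // f Jf; apply: annC => g _; rewrite mulrC.
    by case: (idc d) => _ _; apply; apply: J_colon.
  move=> e C chainC; apply: prime_chain_length chainC _ => s cards.
  (* The [D]-th power of the product of the variables in [s] lies in [J] because [F_(d+1)] is the
     whole ring. *)
  exists (lift D s 0%MM); last exact: full.
  by move=> j js; rewrite mnmE (negPf js) mnm0E.
exists (fun i => monomial_span (colon U D i)); split.
- move=> f; split=> [Uf|]; last exact: J_colon.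
  by apply/JE => m /Uf/colon0.
- by move=> f m _.
- by move=> i _; apply: monomial_span_homogeneous.
- by move=> i lt f Uf m /Uf; apply: mono.
move=> i lt; case: (boolp.pselect (exists2 a, colon U D i.+1 a & ~ colon U D i a)) => [ex|none].
  right; apply: cohen_macaulay_of_regular (pureq i lt ex) _ => //.
  - exact: size_elementary.
  - exact: elementary_irrelevant.
  move=> e C chainC; apply: prime_chain_length chainC _ => s cards.
  (* The same monomial multiplies [F_(i+1)] into [J], hence into [F_i]. *)
  exists (lift D s 0%MM); first by move=> j js; rewrite mnmE (negPf js) mnm0E.
  move=> f Vf; apply/monomial_span_mulX => c /Vf/(_ s cards) Uc t _.
  by apply: up_closed_le Uc => // j; rewrite !mnmE; lia.
left=> f Vf m /Vf Vm; apply: boolp.contrapT => nUm; apply: none; by exists m.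
Qed.
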